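(* Let $h:Y\to Y$ be a homeomorphism of a smooth fan $Y$. Then $h$ is not separated, continuum-wise semi-turbulent. Hence, smooth fans do not admit separated continuum-wise turbulent homeomorphisms.
   Context: A continuum is a nonempty compact connected metric space; a subcontinuum of a space is a subspace that is a continuum. The Cantor fan is the quotient $F_p$ of $C\times[0,1]$, where $C$ is a Cantor set, obtained by identifying $C\times\{0\}$ to a single point $p$. A smooth fan is a continuum that can be embedded in the Cantor fan (arcs are trivial smooth fans). For a compact metric space $X$, a continuous function $h:X\to X$ is separated, continuum-wise semi-turbulent if there exist a continuum $Z$, disjoint subcontinua $A,B$ of $X$, and continuous functions $\phi:X\to Z$, $f:Z\to Z$ such that (1) $f\circ\phi=\phi\circ h$; (2) $\phi(A)\cap\phi(B)=\emptyset$; (3) $\phi(A)\cup\phi(B)\subset\phi(h(A))\cap\phi(h(B))$. A continuous function $h:X\to X$ is separated, continuum-wise turbulent if there are disjoint subcontinua $A,B$ of $X$ with $A\cup B\subset h(A)\cap h(B)$. *)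

(* Defs.v *)
From HB Require Import structures.
From mathcomp Require Import all_boot all_order all_algebra generic_quotient.
From mathcomp Require Import boolp classical_sets functions reals topology.
From mathcomp Require Import cantor.

Set Implicit Arguments.
Unset Strict Implicit.
Unset Printing Implicit Defensive.

Import Order.TTheory GRing.Theory Num.Theory.
Import numFieldTopology.Exports.

Local Open Scope classical_set_scope.
Local Open Scope ring_scope.

(* Compactness and connectedness of [A] as a subset of [T] are those of the
   subspace; the library's [connected] does not imply nonemptiness. *)
Definition subcontinuum (T : topologicalType) (A : set T) : Prop :=
  [/\ A !=set0, compact A & connected A].

(* Metrizability is carried by the type: this is used at [T : metricType R]. *)
Definition continuum (T : topologicalType) : Prop := subcontinuum [set: T].

Definition homeomorphism (S T : topologicalType) (f : S -> T) : Prop :=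
  continuous f /\
  exists g : T -> S, [/\ continuous g, cancel f g & cancel g f].

(* Homeomorphism onto the image, the latter with the subspace topology. *)
Definition embedding (S T : topologicalType) (f : S -> T) : Prop :=
  [/\ injective f, continuous f &
      forall U : set S, open U ->
        exists2 V : set T, open V & f @` U = V `&` range f].

Section cantor_fan.
Variable R : realType.

Definition cantor_cylinder : Type :=
  (cantor_space * set_type (`[0, 1]%classic : set R))%type.

HB.instance Definition _ := Topological.on cantor_cylinder.

(* Identifies [C * {0}] to a single point, and nothing else. *)
Definition fan_rel_fun : rel cantor_cylinder := fun a b =>
  (a == b) || ((set_val a.2 == 0) && (set_val b.2 == 0)).

Lemma fan_rel_refl : reflexive fan_rel_fun.
Proof. by move=> a; rewrite /fan_rel_fun eqxx. Qed.

Lemma fan_rel_sym : symmetric fan_rel_fun.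
Proof. by move=> a b; rewrite /fan_rel_fun eq_sym andbC. Qed.

Lemma fan_rel_trans : transitive fan_rel_fun.
Proof.
move=> b a c /predU1P[-> //|/andP[a0 b0]] /predU1P[<-|/andP[_ c0]].
  by rewrite /fan_rel_fun a0 b0 orbT.
by rewrite /fan_rel_fun a0 c0 orbT.
Qed.

Definition fan_rel := EquivRel _ fan_rel_refl fan_rel_sym fan_rel_trans.

Definition cantor_fan := {eq_quot fan_rel}%qT.

HB.instance Definition _ :=
  Topological.copy cantor_fan (quotient_topology cantor_fan).

End cantor_fan.

Definition smooth_fan (R : realType) (Y : metricType R) : Prop :=
  continuum Y /\ exists e : Y -> cantor_fan R, embedding e.

Definition separated_cw_semi_turbulent (R : realType) (X : metricType R)
    (h : X -> X) : Prop :=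
  exists (Z : metricType R) (A B : set X) (phi : X -> Z) (f : Z -> Z),
    continuum Z /\
    [/\ subcontinuum A, subcontinuum B & A `&` B = set0] /\
    continuous phi /\ continuous f /\
    [/\ f \o phi = phi \o h,
        phi @` A `&` phi @` B = set0 &
        phi @` A `|` phi @` B `<=` phi @` (h @` A) `&` phi @` (h @` B)].

Definition separated_cw_turbulent (R : realType) (X : metricType R)
    (h : X -> X) : Prop :=
  exists A B : set X,
    [/\ subcontinuum A, subcontinuum B, A `&` B = set0 &
        A `|` B `<=` h @` A `&` h @` B].

(* Main.v *)
Require Import Defs.
From mathcomp Require Import all_boot all_order all_algebra.
From mathcomp Require Import boolp classical_sets functions reals topology.
From mathcomp Require Import cantor normedtype realfun.
From mathcomp Require Import lra zify.

(** Suppose that two disjoint subcontinua A and B of the smooth fan Y, the maps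
  phi and f, and the homeomorphism h form a semi-turbulent configuration. The
  vertex of the fan lies in at most one of A and B, so one of them, say A, sits
  inside a single leg. The radius then identifies A with a compact interval,
  and every iterate of h restricts to an injective path in the fan. The argument
  plays two facts about these paths against each other.

  Too many itineraries. Since f (phi A) and f (phi B) both cover the union of
  phi A and phi B, any finite word in the letters phi A, phi B is the itinerary
  under h of some point of A, read through phi ([finite_itinerary]).

  Too little oscillation. The preimages P and Q of phi A and phi B are disjoint
  compact sets, so there is d > 0 such that a point of P and a point of Q on the
  same leg have radii at least d apart ([leg_gap]). An injective path meets the
  vertex at most once, so one of its halves stays in one leg, where its radius
  is monotone; hence the number of times that it can alternate between P and Q
  is bounded in terms of d only ([alternation_in_fan]).

  To conclude, take more points of A than this bound allows, and give them
  itineraries such that every way of distributing these points between P and Q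
  occurs at some time. At one of these times the points, listed in their order
  along A, alternate between P and Q ([sorted_alternation]), and the iterate of
  h at that time is a path that alternates too often. This replaces a comparison
  of the exponential number of itineraries with their linear growth for
  monotone maps, that is, an entropy argument. The vertex need not be fixed by
  h, because Y may be an arc; this is why a path may cross it once.

  A turbulent homeomorphism is semi-turbulent with Z = Y, phi = id and f = h. *)

Set Implicit Arguments.
Unset Strict Implicit.
Unset Printing Implicit Defensive.

Import Order.TTheory GRing.Theory Num.Theory.
Import numFieldTopology.Exports numFieldNormedType.Exports.

Local Open Scope classical_set_scope.
Local Open Scope ring_scope.

(** * Coordinates on the Cantor fan *)

Section fan_coordinates.
Variable R : realType.
Implicit Types (x y : cantor_fan R) (u : cantor_cylinder R).

Definition radius x : R := set_val (repr x).2.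
(** A junk value at the vertex, which lies on all legs. *)
Definition leg x : cantor_space := (repr x).1.

Lemma pi_eqP u v :
  (\pi_(cantor_fan R) u = \pi_(cantor_fan R) v)%qT <-> fan_rel_fun u v.
Proof.
by split=> [/(@eqquotP _ _ {eq_quot fan_rel R}%qT)//|?];
  apply/(@eqquotP _ _ {eq_quot fan_rel R}%qT).
Qed.

Lemma repr_pi u : fan_rel_fun (repr (\pi_(cantor_fan R) u)%qT) u.
Proof. by apply/pi_eqP; rewrite reprK. Qed.

Lemma radius_pi u : radius (\pi_(cantor_fan R) u)%qT = set_val u.2.
Proof.
by rewrite /radius; case/predU1P: (repr_pi u) => [->|/andP[/eqP-> /eqP->]].
Qed.

Lemma leg_pi u : set_val u.2 != 0 -> leg (\pi_(cantor_fan R) u)%qT = u.1.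
Proof.
rewrite /leg => u0; case/predU1P: (repr_pi u) => [->//|/andP[_]].
by rewrite (negbTE u0).
Qed.

Lemma radius_ge0 x : 0 <= radius x.
Proof. by have := set_valP (repr x).2; rewrite /= in_itv /= => /andP[]. Qed.

Lemma radius_le1 x : radius x <= 1.
Proof. by have := set_valP (repr x).2; rewrite /= in_itv /= => /andP[]. Qed.

Lemma vertex_unique x y : radius x = 0 -> radius y = 0 -> x = y.
Proof.
move=> x0 y0; rewrite -[x]reprK -[y]reprK; apply/pi_eqP.
by apply/orP; right; apply/andP; split; apply/eqP.
Qed.

Lemma leg_radius_inj x y : leg x = leg y -> radius x = radius y -> x = y.
Proof.
move=> lxy rxy; rewrite -[x]reprK -[y]reprK; congr (\pi_ _)%qT.
by apply: injective_projections => //; apply: val_inj.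
Qed.

Lemma radius_continuous : continuous radius.
Proof.
apply/quotient_continuous.
have -> : radius \o \pi_(cantor_fan R)%qT = set_val \o snd.
  by apply/funext => u; exact: radius_pi.
move=> u; apply: continuous_comp; first exact: cvg_snd.
exact: initial_continuous.
Qed.

(** Off the vertex the fan is the product of the Cantor set and a half-open
  interval, so [leg] is continuous there. *)
Lemma open_legs (U : set cantor_space) : open U ->
  open [set x | radius x != 0 /\ U (leg x)].
Proof.
move=> oU.
rewrite /open /= /quotient_open.
rewrite (_ : _ @^-1` _ = (set_val \o snd) @^-1` [set r : R | r != 0] `&`
    fst @^-1` U); last first.
  apply/seteqP; split=> u /=; rewrite radius_pi => -[u0].
    by rewrite leg_pi.
  by move=> Uu; rewrite leg_pi.
apply: openI; apply: open_comp => //.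
- move=> u _; apply: continuous_comp; first exact: cvg_snd.
  exact: initial_continuous.
- by move=> u _; exact: cvg_fst.
Qed.

(** The Cantor set is zero-dimensional: two legs are separated by a clopen set
  of legs, which disconnects the fan minus its vertex. *)
Lemma connected_same_leg (S : set (cantor_fan R)) x y : connected S ->
  (forall z, S z -> radius z != 0) -> S x -> S y -> leg x = leg y.
Proof.
move=> cS S0 Sx Sy; apply: contrapT => /eqP xy.
have [U [[oU cU] Ux Uy]] := cantor_zero_dimensional xy.
apply: Uy.
suff : S `&` [set z | radius z != 0 /\ U (leg z)] = S.
  by move/seteqP => [_ /(_ y Sy)[_ []]].
apply: cS; first by exists x; split=> //; split=> //; exact: S0.
  by eexists; first exact: (open_legs oU).
exists (~` [set z | radius z != 0 /\ (~` U) (leg z)]).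
  by apply: open_closedC; apply: open_legs; exact: closed_openC.
apply/seteqP; split=> z /= [Sz]; first by move=> [z0 Uz]; split=> // -[].
move=> notCU; split=> //; split; first exact: S0.
by apply: contrapT => Uz; apply: notCU; split=> //; exact: S0.
Qed.

(** Near a pair (x, y) in P x Q with different radii the bound holds by
  continuity of the radius. A pair with equal radii is away from the vertex and
  lies on two different legs, since x and y differ, and so does every pair near
  it: there the bound is vacuous. Compactness of P x Q makes the bound
  uniform. *)
Lemma leg_gap (P Q : set (cantor_fan R)) : compact P -> compact Q ->
  P `&` Q = set0 ->
  exists2 d : R, 0 < d & forall x y, P x -> Q y ->
    radius x != 0 -> radius y != 0 -> leg x = leg y ->
    d <= `|radius x - radius y|.
Proof.
move=> cP cQ PQ0.
pose far (d : R) (z : cantor_fan R * cantor_fan R) :=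
  radius z.1 != 0 -> radius z.2 != 0 -> leg z.1 = leg z.2 ->
  d <= `|radius z.1 - radius z.2|.
have : \forall d \near 0^'+, P `*` Q `<=` far d.
  have /compact_near_coveringP := compact_setX cP cQ; apply.
  case=> x y [/= Px Qy].
  have xNy : x <> y.
    by move=> xy; have : set0 x by rewrite -PQ0; split=> //; rewrite xy.
  have dist_cont : continuous (fun z : cantor_fan R * cantor_fan R =>
      `|radius z.1 - radius z.2|).
    have r1 : continuous (radius \o (@fst (cantor_fan R) (cantor_fan R))).
      move=> z; apply: continuous_comp; first exact: cvg_fst.
      exact: radius_continuous.
    have r2 : continuous (radius \o (@snd (cantor_fan R) (cantor_fan R))).
      move=> z; apply: continuous_comp; first exact: cvg_snd.
      exact: radius_continuous.
    by move=> z; apply: cvg_norm; apply: cvgB; [exact: r1|exact: r2].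
  have [rxy|rxy] := eqVneq (radius x) (radius y); last first.
    pose e := `|radius x - radius y| / 2.
    have e0 : 0 < e by rewrite divr_gt0// normr_gt0 subr_eq0.
    exists ([set z : cantor_fan R * cantor_fan R |
      e < `|radius z.1 - radius z.2|], [set d | d < e]).
      split=> /=; last exact: nbhs_right_lt.
      apply: (open_nbhs_nbhs (A := _ @^-1` [set r | e < r])); split.
        apply: open_comp; last exact: open_gt.
        by move=> z _; exact: dist_cont.
      by rewrite /= /e ltr_pdivrMr// ltr_pMr ?normr_gt0 ?subr_eq0// ltr1n.
    by move=> -[z d] /= [ez de] _ _ _; apply: ltW; exact: lt_trans de ez.
  have [x0|x0] := eqVneq (radius x) 0.
    by case: xNy; apply: vertex_unique; rewrite -?rxy.
  have lxy : leg x != leg y.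
    by apply/eqP => lxy; apply: xNy; exact: leg_radius_inj.
  have [U [[oU cU] Ux Uy]] := cantor_zero_dimensional lxy.
  exists ([set z : cantor_fan R * cantor_fan R |
    U (leg z.1) /\ ~ U (leg z.2)], setT).
    split=> /=; last exact: filterT.
    exists ([set z | radius z != 0 /\ U (leg z)],
            [set z | radius z != 0 /\ (~` U) (leg z)]).
      split; apply: open_nbhs_nbhs; split=> //=; rewrite -?rxy //.
        exact: open_legs.
      exact: (open_legs (closed_openC cU)).
    by move=> z /= [[_ ?] [_ ?]].
  by move=> -[z d] /= [[Uz1 Uz2] _] _ _ lz; case: Uz2; rewrite -lz.
move=> far_near; near (0 : R)^'+ => d.
have far_d : P `*` Q `<=` far d by near: d.
exists d; first by near: d; exact: nbhs_right_gt.
by move=> x y Px Qy; exact: (far_d (x, y)).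
Unshelve. all: by end_near. Qed.

End fan_coordinates.

(** * Alternation along injective paths *)

(** The inverse of an injective continuous map on a compact set, extended by an
  arbitrary value outside the image. It pulls closed sets back to images of
  compact sets, which are closed in a Hausdorff space. *)
Lemma compact_inverse_continuous (T U : topologicalType) (A : set T)
    (rho : T -> U) : hausdorff_space U -> A !=set0 -> compact A ->
  continuous rho -> set_inj A rho ->
  exists2 g : U -> T, {within rho @` A, continuous g} &
    forall a, A a -> g (rho a) = a.
Proof.
move=> hU [a0 _] cA crho irho.
have [g gK] : exists g, forall a, A a -> g (rho a) = a.
  exists (fun r => xget a0 [set a | A a /\ rho a = r]) => a Aa.
  have [Ab rb] := @xgetPex _ a0 [set b | A b /\ rho b = rho a]
    (ex_intro _ a (conj Aa erefl)).
  by apply: irho => //; rewrite inE.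
exists g => //; apply/continuous_closedP => D cD; apply/closed_subspaceP.
exists (rho @` (A `&` D)).
  apply: compact_closed => //; apply: continuous_compact.
    exact: continuous_subspaceT.
  exact: compact_closedI.
apply/seteqP; split=> r /=.
  move=> [[a [Aa Da] <-] _]; rewrite /from_subspace gK//.
  by split=> //; exists a.
by move=> [+ [a Aa ar]]; rewrite -ar /from_subspace gK// => Da; split; exists a.
Qed.

Lemma steps_le1 (R : realType) (v : nat -> R) (d : R) (m : nat) :
  (forall i, 0 <= v i <= 1) ->
  (forall i, (i < m)%N -> v i + d <= v i.+1) -> m%:R * d <= 1.
Proof.
move=> v01 step.
have : forall i, (i <= m)%N -> v 0%N + i%:R * d <= v i.
  elim=> [|i IH] im; first by rewrite mul0r addr0.
  by have := step i im; have := IH (ltnW im); rewrite -[i.+1]addn1 natrD; lra.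
move=> /(_ m (leqnn m)); have := v01 0%N; have := v01 m; lra.
Qed.

Lemma increasing_within (R : realType) (s : nat -> R) (m : nat) :
  (forall i, (i < m)%N -> s i < s i.+1) ->
  forall i j, (i <= j <= m)%N -> s i <= s j.
Proof.
move=> sS i; elim=> [|j IH] /andP[ij jm].
  by move: ij; rewrite leqn0 => /eqP ->.
move: ij; rewrite leq_eqVlt => /predU1P[->//|ij].
by apply: le_trans (IH _) (ltW (sS j jm)); rewrite -ltnS ij ltnW.
Qed.

(** The two sets are indexed by [bool], so that alternating between them along a
  sequence of times means being in the set indexed by the parity of the
  position. *)
Definition leg_separated (R : realType) (P : bool -> set (cantor_fan R))
    (d : R) : Prop :=
  forall b x y, P b x -> P (~~ b) y ->
    radius x != 0 -> radius y != 0 -> leg x = leg y ->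
    d <= `|radius x - radius y|.

(** A path that avoids the vertex stays in one leg, so by injectivity its radius
  is monotone, and each of the m alternations costs at least d out of the length
  1 of the leg. *)
Lemma alternation_in_leg (R : realType) (P : bool -> set (cantor_fan R)) (d : R)
    (gam : R -> cantor_fan R) (s : nat -> R) (m : nat) (b : bool) :
  leg_separated P d ->
  (forall i, (i < m)%N -> s i < s i.+1) ->
  {within `[s 0%N, s m], continuous gam} ->
  set_inj `[s 0%N, s m] gam ->
  (forall t, `[s 0%N, s m]%classic t -> radius (gam t) != 0) ->
  (forall i, (i <= m)%N -> P (b (+) odd i) (gam (s i))) ->
  m%:R * d <= 1.
Proof.
move=> gap sS cgam igam gam0 Pgam.
have leg_const t u : `[s 0%N, s m]%classic t -> `[s 0%N, s m]%classic u ->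
    leg (gam t) = leg (gam u).
  move=> It Iu; apply: (@connected_same_leg _ (gam @` `[s 0%N, s m])).
  - by apply: connected_continuous_connected => //; exact: segment_connected.
  - by move=> _ [w Iw <-]; exact: gam0.
  - by exists t.
  - by exists u.
pose v t := radius (gam t).
have cv : {within `[s 0%N, s m], continuous v}.
  move=> t; apply: (@continuous_comp _ _ _ (gam : subspace _ -> _)).
    exact: cgam.
  exact: radius_continuous.
have iv : {in `[s 0%N, s m] &, injective v}.
  move=> t u It Iu tu; apply: igam; rewrite ?inE//.
  by apply: leg_radius_inj => //; exact: leg_const.
have sI i : (i <= m)%N -> s i \in `[s 0%N, s m].
  move=> im; rewrite in_itv/=.
  by apply/andP; split; apply: (increasing_within sS); rewrite ?leqnn ?im.
have v_gap i : (i < m)%N -> d <= `|v (s i) - v (s i.+1)|.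
  move=> im; have im' := ltnW im.
  apply: (gap (b (+) odd i)).
  - exact: Pgam.
  - by have := Pgam i.+1 im; rewrite /= addbN.
  - by apply: gam0; exact: sI.
  - by apply: gam0; exact: sI.
  - by apply: leg_const; exact: sI.
have v01 t : 0 <= v t <= 1 by rewrite radius_ge0 radius_le1.
have [vinc|vdec] := itv_continuous_inj_mono cv iv.
  apply: (@steps_le1 _ (v \o s)) => [i|i im /=]; first exact: v01.
  have : v (s i) <= v (s i.+1).
    by apply/ltW/vinc; [apply: sI; exact: ltnW|exact: sI|exact: sS].
  by have := v_gap i im; rewrite distrC => + le; rewrite ger0_norm; lra.
apply: (@steps_le1 _ (fun i => 1 - v (s i))) => [i|i im /=].
  by have := v01 (s i); lra.
have : v (s i.+1) <= v (s i).
  by apply/ltW/vdec; [exact: sI|apply: sI; exact: ltnW|exact: sS].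
by have := v_gap i im => + le; rewrite ger0_norm; lra.
Qed.

(** Among 2m + 2 times, the first m + 1 and the last m + 1 span disjoint
  segments; an injective path meets the vertex on at most one of them, and the
  bound for a single leg applies on the other. *)
Lemma alternation_in_fan (R : realType) (P : bool -> set (cantor_fan R)) (d : R)
    (gam : R -> cantor_fan R) (t : nat -> R) (m : nat) :
  leg_separated P d ->
  (forall i, (i < m.*2.+1)%N -> t i < t i.+1) ->
  {within `[t 0%N, t m.*2.+1], continuous gam} ->
  set_inj `[t 0%N, t m.*2.+1] gam ->
  (forall i, (i <= m.*2.+1)%N -> P (odd i) (gam (t i))) ->
  m%:R * d <= 1.
Proof.
move=> gap tS cgam igam Pgam; have tle := increasing_within tS.
have mle : (m <= m.*2.+1)%N by rewrite -addnn; lia.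
have sub1 : `[t 0%N, t m] `<=` `[t 0%N, t m.*2.+1].
  apply: subset_itvl; rewrite bnd_simp; apply: tle; rewrite mle leqnn //.
have sub2 : `[t m.+1, t m.*2.+1] `<=` `[t 0%N, t m.*2.+1].
  apply: subset_itvr; rewrite bnd_simp; apply: tle; rewrite /= -addnn; lia.
have [[w Iw w0]|no_vertex] :=
    pselect (exists2 w, `[t 0%N, t m]%classic w & radius (gam w) = 0);
  last first.
  apply: (@alternation_in_leg _ P d gam t m false) => //.
  - by move=> i im; apply: tS; exact: leq_trans im mle.
  - exact: continuous_subspaceW cgam.
  - apply: sub_in2 igam => z; rewrite !inE; exact: sub1.
  - by move=> w Iw; apply/eqP => w0; apply: no_vertex; exists w.
  - by move=> i im; apply: Pgam; exact: leq_trans im mle.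
(* The last half starts at position m + 1, whose parity shifts the labels. *)
apply: (@alternation_in_leg _ P d gam (fun i => t (m.+1 + i)%N) m (odd m.+1));
  rewrite ?addn0.
- exact: gap.
- by move=> i im; rewrite addnS; apply: tS; rewrite -addnn; lia.
- by rewrite addSn addnn; exact: continuous_subspaceW cgam.
- by rewrite addSn addnn; apply: sub_in2 igam => z; rewrite !inE; exact: sub2.
- rewrite addSn addnn => u Iu; apply/eqP => u0.
  have uw : u = w.
    apply: igam; rewrite ?inE; [exact: sub2|exact: sub1|exact: vertex_unique].
  move: Iu Iw; rewrite uw /= !in_itv /= => /andP[tu _] /andP[_ ut].
  have := tS m; rewrite -addnn; have/[swap]/[apply] : (m < (m + m).+1)%N by lia.
  by rewrite ltNge (le_trans tu ut).
- by move=> i im; rewrite -oddD; apply: Pgam; rewrite -addnn; lia.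
Qed.

(** * Itineraries *)

(** Built backwards. For a word with first letter b, some a' in A b realises the
  remaining letters by induction; the covering condition gives a in A c with
  phi (h a) = phi a', and by the semiconjugacy phi cannot tell h a from a' at
  any later time. Only the images under phi are controlled: h a need not lie in
  A b. *)
Lemma finite_itinerary (Y Z : Type) (h : Y -> Y) (phi : Y -> Z) (f : Z -> Z)
    (A : bool -> set Y) : (forall c, A c !=set0) ->
  f \o phi = phi \o h ->
  (forall b c, phi @` A b `<=` phi @` (h @` A c)) ->
  forall (s : seq bool) c, exists2 a, A c a &
    forall k, (k < size s)%N ->
      (phi @` A (nth false s k)) (phi (iter k.+1 h a)).
Proof.
move=> A_neq0 fphi cover.
have phi_iter k a a' : phi a = phi a' -> phi (iter k h a) = phi (iter k h a').
  move=> aa'; elim: k => //= k IH.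
  by rewrite -!/((phi \o h) _) -fphi /= IH.
elim=> [|b s IH] c; first by have [a Aa] := A_neq0 c; exists a.
have [a' Aa' itin] := IH b.
have [_ [a Aa <-] ha] := cover b c _ (ex_intro2 _ _ a' Aa' erefl).
exists a => // -[_|k ks]; first by exists a'.
by have := itin k ks; rewrite -(phi_iter k.+1 (h a) a')// -iterSr.
Qed.

(** The labelling [w] depends on the order of the values [r j], which is unknown
  when the points are chosen; this is why they have to realise all labellings. *)
Lemma sorted_alternation (R : realDomainType) (n : nat) (r : 'I_n -> R) :
  injective r ->
  exists (t : nat -> R) (w : {ffun 'I_n -> bool}),
    (forall i, (i.+1 < n)%N -> t i < t i.+1) /\
    (forall i, (i < n)%N -> exists2 j, r j = t i & w j = odd i).
Proof.
move=> rI; pose s := sort <=%R [seq r i | i <- enum 'I_n].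
have size_s : size s = n by rewrite size_sort size_map size_enum_ord.
have uniq_s : uniq s by rewrite sort_uniq map_inj_uniq// enum_uniq.
have s_lt : sorted <%R s by rewrite sort_lt_sorted map_inj_uniq// enum_uniq.
exists (nth 0 s), [ffun j => odd (index (r j) s)]; split=> i iN.
  by apply: (sorted_ltn_nth lt_trans) => //; rewrite inE size_s// ltnW.
have : nth 0 s i \in s by rewrite mem_nth// size_s.
rewrite mem_sort => /mapP[j _ jE]; exists j => //.
by rewrite ffunE -jE index_uniq// size_s.
Qed.

(** * Smooth fans *)

(** The subcontinuum indexed by [false] avoids the vertex, so it lies in one leg:
  the points are taken in it, and the other subcontinuum only labels them. *)
Lemma no_horseshoe_off_vertex (R : realType) (Y Z : topologicalType)
    (e : Y -> cantor_fan R) (h : Y -> Y) (phi : Y -> Z) (f : Z -> Z)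
    (A : bool -> set Y) :
  hausdorff_space Z -> compact [set: Y] ->
  continuous e -> injective e -> continuous h -> injective h ->
  continuous phi ->
  f \o phi = phi \o h ->
  (forall b, subcontinuum (A b)) ->
  phi @` A true `&` phi @` A false = set0 ->
  (forall a, A false a -> radius (e a) != 0) ->
  ~ (forall b c, phi @` A b `<=` phi @` (h @` A c)).
Proof.
move=> hZ cY ce ie ch ih cphi fphi cA disj A0 cover.
pose P b := e @` (phi @^-1` (phi @` A b)).
have cP b : compact (P b).
  apply: continuous_compact; first exact: continuous_subspaceT.
  apply: (subclosed_compact _ cY) => //.
  apply: closed_comp; first by move=> ? _; exact: cphi.
  apply: compact_closed => //; apply: continuous_compact.
    exact: continuous_subspaceT.
  by have [] := cA b.
have PI : P true `&` P false = set0.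
  rewrite -subset0 => _ [[y Py <-] [y' Py' /ie yy']].
  suff : set0 (phi y) by [].
  by rewrite -disj; split=> //; rewrite -yy'.
have [d d0 gap] := leg_gap (cP true) (cP false) PI.
have gap2 : leg_separated P d.
  case=> x y Px Py rx ry lxy; first exact: gap.
  by rewrite distrC; apply: gap.
pose m := Num.bound d^-1.
have md : 1 < m%:R * d.
  by rewrite -ltr_pdivrMr// mul1r; apply: archi_boundP; rewrite invr_ge0 ltW.
pose n := m.*2.+2.
(* At time k + 1, the points are to be distributed according to labelling k; the
   itinerary of point i lists the i-th labels. *)
pose ws := enum {ffun 'I_n -> bool}.
have A_nonempty b : A b !=set0 by have [] := cA b.
have /choice[a a_itin] : forall i : 'I_n, exists a, A false a /\
    forall w : {ffun 'I_n -> bool},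
      (phi @` A (w i)) (phi (iter (index w ws).+1 h a)).
  move=> i; have [a Aa itin] := finite_itinerary A_nonempty fphi cover
    [seq w i | w : {ffun 'I_n -> bool} <- ws] false.
  exists a; split=> // w.
  have wws : (index w ws < size ws)%N by rewrite index_mem mem_enum.
  have := itin (index w ws); rewrite size_map => /(_ wws).
  by rewrite (nth_map w)// nth_index// mem_enum.
pose rho := @radius R \o e.
have crho : continuous rho.
  by move=> y; apply: continuous_comp; [exact: ce|exact: radius_continuous].
have [A_neq0 cptA connA] := cA false.
have irho : set_inj (A false) rho.
  move=> x y; rewrite !inE => Ax Ay rxy; apply: ie; apply: leg_radius_inj => //.
  apply: (@connected_same_leg _ (e @` A false)).
  - by apply: connected_continuous_connected => //; exact: continuous_subspaceT.
  - by move=> _ [z Az <-]; exact: A0.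
  - by exists x.
  - by exists y.
have [g cg gK] :=
  compact_inverse_continuous (@Rhausdorff R) A_neq0 cptA crho irho.
(* Two points with the same radius coincide, but some labelling separates their
   itineraries. *)
have r_inj : injective (rho \o a).
  move=> i j rij; have aij : a i = a j.
    by apply: irho; rewrite ?inE //; [case: (a_itin i)|case: (a_itin j)].
  apply/eqP; rewrite eq_sym; apply: contrapT => /negP ij.
  pose w := [ffun k => k == i] : {ffun 'I_n -> bool}.
  have [_ /(_ w)] := a_itin i; have [_ /(_ w)] := a_itin j.
  rewrite !ffunE eqxx (negbTE ij) aij => phiA_false phiA_true.
  suff : set0 (phi (iter (index w ws).+1 h (a j))) by [].
  by rewrite -disj.
have [t [w [tS tw]]] := sorted_alternation r_inj.
have t_rho i : (i < n)%N -> (rho @` A false) (t i).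
  by move=> /tw[j <- _]; exists (a j) => //; case: (a_itin j).
have seg : `[t 0%N, t m.*2.+1] `<=` rho @` A false.
  have /connected_intervalP itvA : connected (rho @` A false).
    by apply: connected_continuous_connected => //; exact: continuous_subspaceT.
  move=> u /=; rewrite in_itv/= => tut; apply: itvA tut; exact: t_rho.
pose hk := iter (index w ws).+1 h.
have [chk ihk] : continuous hk /\ injective hk.
  rewrite /hk; elim: (index w ws).+1 => [|k [ck ik]] /=.
    by split=> // y; exact: cvg_id.
  split=> [y|x y /ih /ik //].
  by apply: (@continuous_comp _ _ _ (iter k h) h); [exact: ck|exact: ch].
suff : m%:R * d <= 1 by rewrite leNgt md.
apply: (alternation_in_fan gap2 (gam := e \o hk \o g) (t := t)).
- by move=> i im; apply: tS.
- apply: (continuous_subspaceW seg) => y.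
  apply: (@continuous_comp _ _ _ (g : subspace _ -> _) (e \o hk)).
    exact: cg.
  by apply: continuous_comp; [exact: chk|exact: ce].
- move=> x y; rewrite !inE => /seg[p Ap <-] /seg[q Aq <-] /=.
  by rewrite !gK// => /ie /ihk ->.
- move=> i im; have [j rj wj] := tw i im; have [Aj /(_ w)] := a_itin j.
  by rewrite wj => Pj; rewrite -rj /= gK//; exists (hk (a j)).
Qed.

Theorem corollary7p16 (R : realType) (Y : metricType R) (hY : smooth_fan Y) :
  (forall h : Y -> Y, homeomorphism h -> ~ separated_cw_semi_turbulent h) /\
  ~ (exists h : Y -> Y, homeomorphism h /\ separated_cw_turbulent h).
Proof.
have semi (h : Y -> Y) : homeomorphism h -> ~ separated_cw_semi_turbulent h.
  move=> [ch [h' [_ hK _]]] [Z [A [B [phi [f]]]]].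
  move=> [_ [[cA cB AB0] [cphi [_ [fphi disj cover]]]]].
  have [[_ cY _] [e [ie ce _]]] := hY.
  have sub D : D = A \/ D = B ->
      phi @` D `<=` phi @` (h @` A) `&` phi @` (h @` B).
    by case=> -> y Dy; apply: cover; [left|right].
  (* The vertex is in at most one of A and B; one that avoids it carries the
     points. *)
  have [[x Ax x0]|noA] := pselect (exists2 x, A x & radius (e x) = 0).
    apply: (@no_horseshoe_off_vertex _ _ _ e h phi f
      (fun b => if b then A else B)) => //.
    - exact: metric_hausdorff.
    - exact: can_inj hK.
    - by case.
    - move=> y By; apply/eqP => y0.
      suff : set0 y by [].
      by rewrite -AB0; split=> //; rewrite (ie y x)//; exact: vertex_unique.
    - by move=> [] [] y /sub[] //; [left|left|right|right].
  apply: (@no_horseshoe_off_vertex _ _ _ e h phi f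
      (fun b => if b then B else A)) => //.
  - exact: metric_hausdorff.
  - exact: can_inj hK.
  - by case.
  - by rewrite setIC.
  - by move=> y Ay; apply/eqP => y0; apply: noA; exists y.
  - by move=> [] [] y /sub[] //; [right|right|left|left].
split=> // -[h [homeo_h [A [B [cA cB AB0 cover]]]]].
apply: (semi h homeo_h); exists Y, A, B, id, h.
split; first by case: hY.
split; first by [].
split; first by move=> y; exact: cvg_id.
split; first by case: homeo_h.
by rewrite !image_id.
Qed.
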